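(* Consider the two-dimensional compressible Euler equations and one curved quadrilateral element $\Omega_e$ with element mapping $(x,y)=(x(\xi,\eta),y(\xi,\eta))$ from $[-1,1]^2$, whose nodal geometric derivatives satisfy the discrete metric identities. Let $\bm U=\bm U_N^e(t)=(U_1,U_2,U_3,U_4)^T\in[\mathbb Q_N([-1,1]^2)]^4$, with nodal values $(U_k)_{p_1,p_2}(t)$ differentiable in $t$ and positive density and pressure at all nodes, satisfy the entropy-stable DGSEM on $\Omega_e$ (all objects as defined in the context): for all $0\le p_1,p_2\le N$ and $k=1,\dots,4$, \[ \begin{aligned} &w_{p_1}w_{p_2}\Bigl(\mathcal J_{p_1,p_2}(\partial_tU_k)_{p_1,p_2}+2\sum_{i=0}^N D_{p_1,i}(\tilde f_k^{\#})_{(i,p_1),p_2}+2\sum_{j=0}^N D_{p_2,j}(\tilde g_k^{\#})_{p_1,(j,p_2)}\Bigr)\\ &+w_{p_1}\Bigl((\tilde g_k-\tilde g_k^* )_{p_1,0}\delta_{p_2,0}-(\tilde g_k-\tilde g_k^* )_{p_1,N}\delta_{p_2,N}\Bigr)+w_{p_2}\Bigl((\tilde f_k-\tilde f_k^* )_{0,p_2}\delta_{p_1,0}-(\tilde f_k-\tilde f_k^* )_{N,p_2}\delta_{p_1,N}\Bigr)=0 . \end{aligned} \] Then for $k=1,2,3,4$, \[ \sum_{p_1,p_2=0}^N w_{p_1}w_{p_2}\mathcal J_{p_1,p_2}(\partial_tU_k)_{p_1,p_2}=\sum_{p_1=0}^N w_{p_1}\bigl((\tilde g_k^* )_{p_1,0}-(\tilde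 g_k^* )_{p_1,N}\bigr)+\sum_{p_2=0}^N w_{p_2}\bigl((\tilde f_k^* )_{0,p_2}-(\tilde f_k^* )_{N,p_2}\bigr). \] Moreover, the discrete entropy evolves according to \[ \begin{aligned} \sum_{p_1,p_2=0}^N w_{p_1}w_{p_2}\mathcal J_{p_1,p_2}\bigl(\partial_t S(\bm U)\bigr)_{p_1,p_2} ={}&\sum_{p_1=0}^N w_{p_1}\Bigl(\sum_{k=1}^4(\tilde g_k^* )_{p_1,0}(V_k)_{p_1,0}-\tilde\psi^{g}_{p_1,0}\Bigr)\\ &-\sum_{p_1=0}^N w_{p_1}\Bigl(\sum_{k=1}^4(\tilde g_k^* )_{p_1,N}(V_k)_{p_1,N}-\tilde\psi^{g}_{p_1,N}\Bigr)\\ &+\sum_{p_2=0}^N w_{p_2}\Bigl(\sum_{k=1}^4(\tilde f_k^* )_{0,p_2}(V_k)_{0,p_2}-\tilde\psi^{f}_{0,p_2}\Bigr)\\ &-\sum_{p_2=0}^N w_{p_2}\Bigl(\sum_{k=1}^4(\tilde f_k^* )_{N,p_2}(V_k)_{N,p_2}-\tilde\psi^{f}_{N,p_2}\Bigr). \end{aligned} \]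
   Context: **Euler equations.** $\partial_t\bm U+\partial_x\bm f(\bm U)+\partial_y\bm g(\bm U)=0$, $\bm U=(\rho,\rho u,\rho v,E)^T$, $\bm f=(\rho u,\rho u^2+p,\rho uv,(E+p)u)^T$, $\bm g=(\rho v,\rho uv,\rho v^2+p,(E+p)v)^T$, with $E=\rho e+\tfrac12\rho(u^2+v^2)$, $p=(\gamma-1)\rho e$, $\gamma=1.4$. Admissible states have $\rho>0$, $p>0$. **Entropy.** $S(\bm U)=-\rho s/(\gamma-1)$ with $s=\log(p\rho^{-\gamma})$ (the letter $\eta$ is reserved here for a coordinate). Entropy variables: $V_k=\partial S/\partial U_k$, evaluated at the nodal states. Entropy potential fluxes: $\psi^f=\rho u$, $\psi^g=\rho v$. **Nodal DG.** $\{\xi_i\}_{i=0}^N$ are the $N+1$ Legendre–Gauss–Lobatto (LGL) points on $[-1,1]$ ($N\ge1$, $\xi_0=-1$, $\xi_N=1$; the same points $\eta_j=\xi_j$ are used in the $\eta$ direction), $w_i$ are the LGL quadrature weights, $\phi_j$ the Lagrange polynomials with $\phi_j(\xi_i)=\delta_{ij}$, and $D_{i,j}=\phi_j'(\xi_i)$. $\mathbb Q_N([-1,1]^2)=\mathrm{span}\{\phi_i(\xi)\phi_j(\eta):0\le i,j\le N\}$. A subscript $(\cdot)_{i,j}$ denotes the value at the node $(\xi_i,\eta_j)$. **Geometry.** The element mapping is a smooth invertible map $(x(\xi,\eta),y(\xi,\eta))$ from $[-1,1]^2$ onto $\Omega_e$, with Jacobian $\mathcal J=x_\xi y_\eta-x_\eta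 y_\xi>0$. Nodal values of $x_\xi,x_\eta,y_\xi,y_\eta$ are used. The discrete metric identities are: for all $0\le q_1,q_2\le N$, \[ \sum_{p=0}^N D_{q_2,p}(y_\xi)_{q_1,p}=\sum_{p=0}^N D_{q_1,p}(y_\eta)_{p,q_2},\qquad \sum_{p=0}^N D_{q_2,p}(x_\xi)_{q_1,p}=\sum_{p=0}^N D_{q_1,p}(x_\eta)_{p,q_2}. \] **Contravariant fluxes and potentials (at each node).** $\tilde f_k=y_\eta f_k(\bm U)-x_\eta g_k(\bm U)$, $\tilde g_k=-y_\xi f_k(\bm U)+x_\xi g_k(\bm U)$, $\tilde\psi^f=y_\eta\psi^f-x_\eta\psi^g$, $\tilde\psi^g=-y_\xi\psi^f+x_\xi\psi^g$. **Two-point volume flux (Chandrashekar).** For two states $L,R$ let $\{\!\{a\}\!\}=\tfrac12(a_L+a_R)$, $a^{\log}=\frac{a_L-a_R}{\log a_L-\log a_R}$ (with $a^{\log}=a_L$ if $a_L=a_R$), $\beta=\rho/(2p)$, $\hat p=\frac{\{\!\{\rho\}\!\}}{2\{\!\{\beta\}\!\}}$, and \[ \hat h=\frac{1}{2\beta^{\log}(\gamma-1)}-\tfrac12\bigl(\{\!\{u^2\}\!\}+\{\!\{v^2\}\!\}\bigr)+\frac{\hat p}{\rho^{\log}}+\{\!\{u\}\!\}^2+\{\!\{v\}\!\}^2 . \] Then $\bm f^\#=(\rho^{\log}\{\!\{u\}\!\},\ \rho^{\log}\{\!\{u\}\!\}^2+\hat p,\ \rho^{\log}\{\!\{u\}\!\}\{\!\{v\}\!\},\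 \rho^{\log}\{\!\{u\}\!\}\hat h)^T$ and $\bm g^\#=(\rho^{\log}\{\!\{v\}\!\},\ \rho^{\log}\{\!\{u\}\!\}\{\!\{v\}\!\},\ \rho^{\log}\{\!\{v\}\!\}^2+\hat p,\ \rho^{\log}\{\!\{v\}\!\}\hat h)^T$. The subscript $(i,p_1),p_2$ means the two states (or metric values) are those at nodes $(\xi_i,\eta_{p_2})$ and $(\xi_{p_1},\eta_{p_2})$; the subscript $p_1,(j,p_2)$ means those at $(\xi_{p_1},\eta_j)$ and $(\xi_{p_1},\eta_{p_2})$. The contravariant volume fluxes are \[ (\tilde f_k^\#)_{(i,p_1),p_2}=\{\!\{y_\eta\}\!\}_{(i,p_1),p_2}(f_k^\#)_{(i,p_1),p_2}-\{\!\{x_\eta\}\!\}_{(i,p_1),p_2}(g_k^\#)_{(i,p_1),p_2}, \] \[ (\tilde g_k^\#)_{p_1,(j,p_2)}=-\{\!\{y_\xi\}\!\}_{p_1,(j,p_2)}(f_k^\#)_{p_1,(j,p_2)}+\{\!\{x_\xi\}\!\}_{p_1,(j,p_2)}(g_k^\#)_{p_1,(j,p_2)} . \] **Numerical surface fluxes.** $\tilde f_k^*$ is needed only at nodes with $\xi=\pm1$ and $\tilde g_k^*$ only at nodes with $\eta=\pm1$. With $\bm n$ the outward unit normal of $\Omega_e$ at such a node: $\tilde f_k^*=\pm|(y_\eta,-x_\eta)|\,\bm F_k^*\cdot\bm n$ on $\xi=\pm1$, and $\tilde g_k^*=\pm|(-y_\xi,x_\xi)|\,\bm F_k^*\cdot\bm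 n$ on $\eta=\pm1$, where $\bm F_k^*\cdot\bm n$ is the local Lax–Friedrichs flux \[ \bm F_k^*\cdot\bm n=\tfrac12\,\bm n\cdot\bigl(\bm F_k(\bm U_L)+\bm F_k(\bm U_R)\bigr)-\tfrac{\alpha}{2}\bigl((U_k)_R-(U_k)_L\bigr),\quad \alpha=\max\{|\bm u_L\cdot\bm n|+c_L,\ |\bm u_R\cdot\bm n|+c_R\}, \] with $\bm F_k=(f_k,g_k)$, $\bm u=(u,v)$, $c=\sqrt{\gamma p/\rho}$, $\bm U_L$ the nodal state of $\Omega_e$ and $\bm U_R$ the (admissible) exterior state at the same boundary point, supplied by the neighbouring element or the boundary condition. *)

(* Defs.v *)
From HB Require Import structures.
From mathcomp Require Import all_boot all_order all_algebra.
From mathcomp Require Import all_classical all_reals all_analysis.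
Import Order.TTheory GRing.Theory Num.Theory.
Import numFieldNormedType.Exports.

Set Implicit Arguments.
Unset Strict Implicit.
Unset Printing Implicit Defensive.

Local Open Scope classical_set_scope.
Local Open Scope ring_scope.

(** * Compressible Euler equations *)

Section Euler.
Context {R : realType}.

Definition gamma : R := 14%:R / 10%:R.

Definition row4 (a b c d : R) : 'rV[R]_4 := \row_(k < 4) [:: a; b; c; d]`_k.

(* A state is the row of conserved variables (rho, rho u, rho v, E). *)
Definition rho (U : 'rV[R]_4) : R := U 0 0.
Definition velx (U : 'rV[R]_4) : R := U 0 1 / rho U.
Definition vely (U : 'rV[R]_4) : R := U 0 2 / rho U.
Definition energy (U : 'rV[R]_4) : R := U 0 3.
(* p = (gamma - 1) rho e, where E = rho e + rho (u^2 + v^2) / 2 *)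
Definition pressure (U : 'rV[R]_4) : R :=
  (gamma - 1) * (energy U - 2^-1 * rho U * (velx U ^+ 2 + vely U ^+ 2)).
Definition sound_speed (U : 'rV[R]_4) : R :=
  Num.sqrt (gamma * pressure U / rho U).

Definition admissible (U : 'rV[R]_4) : Prop := 0 < rho U /\ 0 < pressure U.

Definition flux_f (U : 'rV[R]_4) : 'rV[R]_4 :=
  row4 (rho U * velx U) (rho U * velx U ^+ 2 + pressure U)
       (rho U * velx U * vely U) ((energy U + pressure U) * velx U).
Definition flux_g (U : 'rV[R]_4) : 'rV[R]_4 :=
  row4 (rho U * vely U) (rho U * velx U * vely U)
       (rho U * vely U ^+ 2 + pressure U) ((energy U + pressure U) * vely U).

Definition entropy (U : 'rV[R]_4) : R :=
  - (rho U * ln (pressure U * rho U `^ (- gamma))) / (gamma - 1).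
Definition entropy_var (U : 'rV[R]_4) (k : 'I_4) : R :=
  'D_(delta_mx 0 k : 'rV[R]_4) entropy U.
Definition psi_f (U : 'rV[R]_4) : R := rho U * velx U.
Definition psi_g (U : 'rV[R]_4) : R := rho U * vely U.

(** * Chandrashekar's two-point flux *)

Definition avg (a b : R) : R := 2^-1 * (a + b).
Definition logmean (a b : R) : R :=
  if a == b then a else (a - b) / (ln a - ln b).
Definition beta (U : 'rV[R]_4) : R := rho U / (2 * pressure U).

Definition phat (L Q : 'rV[R]_4) : R :=
  avg (rho L) (rho Q) / (2 * avg (beta L) (beta Q)).
Definition hhat (L Q : 'rV[R]_4) : R :=
  1 / (2 * logmean (beta L) (beta Q) * (gamma - 1))
  - 2^-1 * (avg (velx L ^+ 2) (velx Q ^+ 2) + avg (vely L ^+ 2) (vely Q ^+ 2))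
  + phat L Q / logmean (rho L) (rho Q)
  + avg (velx L) (velx Q) ^+ 2 + avg (vely L) (vely Q) ^+ 2.

Definition fsharp (L Q : 'rV[R]_4) : 'rV[R]_4 :=
  let r := logmean (rho L) (rho Q) in
  let u := avg (velx L) (velx Q) in
  let v := avg (vely L) (vely Q) in
  row4 (r * u) (r * u ^+ 2 + phat L Q) (r * u * v) (r * u * hhat L Q).
Definition gsharp (L Q : 'rV[R]_4) : 'rV[R]_4 :=
  let r := logmean (rho L) (rho Q) in
  let u := avg (velx L) (velx Q) in
  let v := avg (vely L) (vely Q) in
  row4 (r * v) (r * u * v) (r * v ^+ 2 + phat L Q) (r * v * hhat L Q).

(** * Local Lax-Friedrichs flux in the direction n *)

Definition normal_velocity (n : R * R) (U : 'rV[R]_4) : R :=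
  velx U * n.1 + vely U * n.2.
Definition normal_flux (n : R * R) (U : 'rV[R]_4) : 'rV[R]_4 :=
  n.1 *: flux_f U + n.2 *: flux_g U.
Definition lax_friedrichs (n : R * R) (L Q : 'rV[R]_4) : 'rV[R]_4 :=
  let alpha := Num.max (`|normal_velocity n L| + sound_speed L)
                       (`|normal_velocity n Q| + sound_speed Q) in
  2^-1 *: (normal_flux n L + normal_flux n Q) - (alpha / 2) *: (Q - L).

(** * Geometric terms at one point of the reference square *)

Record metric := Metric { m_xxi : R; m_xeta : R; m_yxi : R; m_yeta : R }.

Definition jac_det (m : metric) : R :=
  m_xxi m * m_yeta m - m_xeta m * m_yxi m.

Definition ct_f (m : metric) (U : 'rV[R]_4) : 'rV[R]_4 :=
  m_yeta m *: flux_f U - m_xeta m *: flux_g U.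
Definition ct_g (m : metric) (U : 'rV[R]_4) : 'rV[R]_4 :=
  - m_yxi m *: flux_f U + m_xxi m *: flux_g U.
Definition ct_psi_f (m : metric) (U : 'rV[R]_4) : R :=
  m_yeta m * psi_f U - m_xeta m * psi_g U.
Definition ct_psi_g (m : metric) (U : 'rV[R]_4) : R :=
  - m_yxi m * psi_f U + m_xxi m * psi_g U.

Definition ct_fsharp (m m' : metric) (L Q : 'rV[R]_4) : 'rV[R]_4 :=
  avg (m_yeta m) (m_yeta m') *: fsharp L Q
  - avg (m_xeta m) (m_xeta m') *: gsharp L Q.
Definition ct_gsharp (m m' : metric) (L Q : 'rV[R]_4) : 'rV[R]_4 :=
  - avg (m_yxi m) (m_yxi m') *: fsharp L Q
  + avg (m_xxi m) (m_xxi m') *: gsharp L Q.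

(* The two sides xi = -1, +1 (or eta = -1, +1) are indexed by false, true. *)
Definition side_sign (b : bool) : R := if b then 1 else -1.

Definition norm2 (a : R * R) : R := Num.sqrt (a.1 ^+ 2 + a.2 ^+ 2).

Definition ct_fstar (m : metric) (b : bool) (n : R * R) (L Q : 'rV[R]_4) :
    'rV[R]_4 :=
  (side_sign b * norm2 (m_yeta m, - m_xeta m)) *: lax_friedrichs n L Q.
Definition ct_gstar (m : metric) (b : bool) (n : R * R) (L Q : 'rV[R]_4) :
    'rV[R]_4 :=
  (side_sign b * norm2 (- m_yxi m, m_xxi m)) *: lax_friedrichs n L Q.

(* n is a unit vector orthogonal to the tangent tau of the boundary edge and
   on the side of d, a direction that leaves the element through that edge.
   A corner node carries one such normal for each of its two edges. *)
Definition outward_unit_normal (tau d n : R * R) : Prop :=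
  [/\ norm2 n = 1, n.1 * tau.1 + n.2 * tau.2 = 0
    & 0 < n.1 * d.1 + n.2 * d.2].
Definition normal_on_xi_side (m : metric) (b : bool) (n : R * R) : Prop :=
  outward_unit_normal (m_xeta m, m_yeta m)
    (side_sign b * m_xxi m, side_sign b * m_yxi m) n.
Definition normal_on_eta_side (m : metric) (b : bool) (n : R * R) : Prop :=
  outward_unit_normal (m_xxi m, m_yxi m)
    (side_sign b * m_xeta m, side_sign b * m_yeta m) n.

End Euler.

Arguments metric : clear implicits.

(** * Element mapping *)

Section Mapping.
Context {R : realType}.

Definition ref_square : set (R * R) :=
  [set q | -1 <= q.1 <= 1 /\ -1 <= q.2 <= 1].

Definition iter_deriv (s : seq (R * R)) (f : R * R -> R) : R * R -> R :=
  foldr (fun v g q => 'D_v g q) f s.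

(* C^oo on A: every iterated directional derivative is differentiable on a
   neighbourhood of A. *)
Definition smooth_near (A : set (R * R)) (f : R * R -> R) : Prop :=
  exists O : set (R * R), [/\ open O, A `<=` O
    & forall s q, O q -> differentiable (iter_deriv s f) q].

Definition metric_at (x y : R * R -> R) (q : R * R) : metric R :=
  Metric ('D_(1, 0) x q) ('D_(0, 1) x q) ('D_(1, 0) y q) ('D_(0, 1) y q).

Definition element_mapping (x y : R * R -> R) (Omega : set (R * R)) : Prop :=
  [/\ smooth_near ref_square x, smooth_near ref_square y,
      set_bij ref_square Omega (fun q => (x q, y q))
    & forall q, ref_square q -> 0 < jac_det (metric_at x y q)].

End Mapping.

(** * Nodal discontinuous Galerkin operators *)

(* Rodrigues' formula *)
Definition legendre (R : realType) (n : nat) : {poly R} :=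
  (2 ^+ n * (n`!)%:R)^-1 *: (('X^2 - 1) ^+ n)^`(n).

Section Nodal.
Context {R : realType} {N : nat}.

(* The Legendre-Gauss-Lobatto points: the endpoints and the zeros of P_N'. *)
Definition lgl_points (xi : 'I_N.+1 -> R) : Prop :=
  [/\ xi ord0 = -1, xi ord_max = 1,
      {homo xi : i j / (i < j)%N >-> i < j}
    & forall i, i != ord0 -> i != ord_max -> root (legendre R N)^`() (xi i)].

Context (xi : 'I_N.+1 -> R).

Definition lagrange_poly (j : 'I_N.+1) : {poly R} :=
  \prod_(m < N.+1 | m != j) ((xi j - xi m)^-1 *: ('X - (xi m)%:P)).

Definition diff_mx (i j : 'I_N.+1) : R := (lagrange_poly j)^`().[xi i].

(* The weights of the interpolatory quadrature rule on the points xi. *)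
Definition quad_weight (i : 'I_N.+1) : R :=
  \int[lebesgue_measure]_(s in `[-1, 1]) (lagrange_poly i).[s].

Definition node (i j : 'I_N.+1) : R * R := (xi i, xi j).

Definition in_QN (f : R * R -> R) : Prop :=
  exists c : 'M[R]_N.+1, forall q,
    f q = \sum_(i < N.+1) \sum_(j < N.+1)
            c i j * (lagrange_poly i).[q.1] * (lagrange_poly j).[q.2].

Definition discrete_metric_identities (m : 'I_N.+1 -> 'I_N.+1 -> metric R) :
    Prop :=
  forall q1 q2 : 'I_N.+1,
    \sum_(p < N.+1) diff_mx q2 p * m_yxi (m q1 p)
      = \sum_(p < N.+1) diff_mx q1 p * m_yeta (m p q2) /\
    \sum_(p < N.+1) diff_mx q2 p * m_xxi (m q1 p)
      = \sum_(p < N.+1) diff_mx q1 p * m_xeta (m p q2).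

Definition side_node (b : bool) : 'I_N.+1 := if b then ord_max else ord0.

(* m, U and dU are the nodal geometric terms, states and time derivatives;
   fstar b p2 is the surface flux at the nodes (0, p2) and (N, p2), gstar b p1
   the one at (p1, 0) and (p1, N), for b = false and b = true. *)
Definition dgsem (m : 'I_N.+1 -> 'I_N.+1 -> metric R)
    (U dU : 'I_N.+1 -> 'I_N.+1 -> 'rV[R]_4)
    (fstar gstar : bool -> 'I_N.+1 -> 'rV[R]_4) : Prop :=
  forall (p1 p2 : 'I_N.+1) (k : 'I_4),
    quad_weight p1 * quad_weight p2 *
      (jac_det (m p1 p2) * dU p1 p2 0 k
       + 2 * (\sum_(i < N.+1) diff_mx p1 i *
                ct_fsharp (m i p2) (m p1 p2) (U i p2) (U p1 p2) 0 k)
       + 2 * (\sum_(j < N.+1) diff_mx p2 j *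
                ct_gsharp (m p1 j) (m p1 p2) (U p1 j) (U p1 p2) 0 k))
    + quad_weight p1 *
      ((ct_g (m p1 ord0) (U p1 ord0) 0 k - gstar false p1 0 k)
         * (p2 == ord0)%:R
       - (ct_g (m p1 ord_max) (U p1 ord_max) 0 k - gstar true p1 0 k)
         * (p2 == ord_max)%:R)
    + quad_weight p2 *
      ((ct_f (m ord0 p2) (U ord0 p2) 0 k - fstar false p2 0 k)
         * (p1 == ord0)%:R
       - (ct_f (m ord_max p2) (U ord_max p2) 0 k - fstar true p2 0 k)
         * (p1 == ord_max)%:R)
    = 0.

End Nodal.

(* Main.v *)
(** Legendre orthogonality makes Lobatto quadrature exact up to degree 2N-1, so
    integrating [(phi_i phi_j)'] gives the summation-by-parts rule
    [w_i D_ij + w_j D_ji = [i = j = N] - [i = j = 0]].  Multiply the scheme by a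
    nodal test function [W] (one for conservation, [V_k] for entropy) and sum.
    On each grid line, exchanging the indices in half of the volume sum turns it
    into boundary terms plus [w_i D_ij (W_i - W_j) F_ij].  For [W = 1] the last
    sum vanishes; for the entropy variables Chandrashekar's flux satisfies
    [(V_L - V_R) . f# = psi_L - psi_R], and what remains, [psi] times the
    discrete derivatives of the metric terms, cancels between the two
    directions by the metric identities. *)
Require Import Defs.
From mathcomp Require Import all_boot all_order all_algebra.
From mathcomp Require Import all_classical all_reals all_analysis.
From mathcomp Require Import zify ring lra.
Import Order.TTheory GRing.Theory Num.Theory.
Import numFieldNormedType.Exports.
Local Open Scope classical_set_scope.
Local Open Scope ring_scope.

(** * Lobatto quadrature and summation by parts *)

Section PolynomialIntegral.
Context {R : realType}.
Implicit Types (p q : {poly R}).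

Definition poly_int p : R := \int[lebesgue_measure]_(s in `[-1, 1]) p.[s].

Lemma integrable_horner p (a b : R) :
  lebesgue_measure.-integrable `[a, b] (EFin \o horner p).
Proof.
apply: continuous_compact_integrable; first exact: segment_compact.
by apply: continuous_subspaceT => s; exact: continuous_horner.
Qed.

Lemma poly_intD p q : poly_int (p + q) = poly_int p + poly_int q.
Proof.
rewrite /poly_int -RintegralD //; try exact: integrable_horner.
by apply: eq_Rintegral => s _; rewrite hornerD.
Qed.

Lemma poly_intZ (c : R) p : poly_int (c *: p) = c * poly_int p.
Proof.
rewrite /poly_int -RintegralZl //; try exact: integrable_horner.
by apply: eq_Rintegral => s _; rewrite hornerZ.
Qed.

Lemma poly_int_sum (I : finType) (F : I -> {poly R}) :
  poly_int (\sum_i F i) = \sum_i poly_int (F i).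
Proof.
apply: (big_morph poly_int poly_intD).
by rewrite -(scale0r (0 : {poly R})) poly_intZ mul0r.
Qed.

Lemma poly_int_deriv p : poly_int p^`() = p.[1] - p.[-1].
Proof.
have contp : continuous (horner p) by move=> s; exact: continuous_horner.
have lt11 : -1 < 1 :> R by lra.
rewrite /poly_int /Rintegral (@continuous_FTC2 _ _ (horner p)) //.
- by apply: continuous_subspaceT => s; exact: continuous_horner.
- split=> [s _||]; first exact: derivable_horner.
    exact: cvg_at_right_filter (contp _).
  exact: cvg_at_left_filter (contp _).
- by move=> s _; rewrite derive1E; apply: derive_val.
Qed.

Lemma poly_int_by_parts p q :
  poly_int (p * q^`()) = (p * q).[1] - (p * q).[-1] - poly_int (p^`() * q).
Proof. by rewrite -poly_int_deriv derivM poly_intD addrC addKr. Qed.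

End PolynomialIntegral.

(** * Orthogonality and degree of the Legendre polynomials *)

Section LegendreOrthogonality.
Context {R : realType}.
Implicit Types (p q : {poly R}).

Lemma leq_size_deriv p : (size p^`() <= (size p).-1)%N.
Proof.
have [->|p0] := eqVneq p 0; first by rewrite deriv0 size_poly0.
by have := lt_size_deriv p0; lia.
Qed.

(** Each differentiation costs at most one factor [q]. For [q = X^2 - 1] and [k < n] a factor
    survives, so the boundary terms at -1 and 1 vanish in integrations by parts. *)
Lemma derivn_exp_factor q n k : (k <= n)%N ->
  exists h, (q ^+ n)^`(k) = q ^+ (n - k) * h.
Proof.
elim: k => [|k IHk] kn; first by exists 1; rewrite derivn0 subn0 mulr1.
have [h eqh] := IHk (ltnW kn).
have [l nkE] : exists l, (n - k = l.+1)%N.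
  by exists (n - k).-1; rewrite prednK // subn_gt0.
exists (q^`() *+ l.+1 * h + q * h^`()).
rewrite derivnS eqh nkE derivM deriv_exp /= subnS nkE /= exprS; ring.
Qed.

Lemma horner_sqrX_sub1 : (('X^2 - 1).[1] = 0 :> R) * (('X^2 - 1).[-1] = 0 :> R).
Proof. by split; rewrite !hornerE ?mulrNN ?sqrrN ?expr1n ?mulr1 subrr. Qed.

(** Each integration by parts moves one derivative onto [p], lowering [k] and the size bound
    together, until the bound forces [p = 0]. *)
Lemma legendre_ibp_orthogonal n k p : (k <= n)%N -> (size p <= k)%N ->
  poly_int (p * (('X^2 - 1) ^+ n)^`(k)) = 0 :> R.
Proof.
elim: k p => [|k IHk] p kn sp.
  move: sp; rewrite leqn0 size_poly_eq0 => /eqP ->.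
  by rewrite mul0r -(scale0r (0 : {poly R})) poly_intZ mul0r.
rewrite derivnS poly_int_by_parts IHk; last 2 first.
- exact: ltnW.
- by have := leq_size_deriv p; lia.
have [h ->] := derivn_exp_factor ('X^2 - 1) n k (ltnW kn).
have [l ->] : exists l, (n - k = l.+1)%N.
  by exists (n - k).-1; rewrite prednK // subn_gt0.
rewrite !hornerM !horner_exp !horner_sqrX_sub1 !expr0n /=.
by rewrite !mul0r !mulr0 !subrr.
Qed.

Lemma legendre_orthogonal n p : (size p <= n)%N ->
  poly_int (p * legendre R n) = 0.
Proof.
move=> sp; rewrite /legendre -scalerAr poly_intZ.
by rewrite legendre_ibp_orthogonal // mulr0.
Qed.

(** With [n.+1] for [n], the power of [X^2 - 1] in Rodrigues' formula has degree 2n+2 and is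
    differentiated n+2 times. The coefficient of index n is then its leading coefficient times a
    nonzero falling factorial. *)
Lemma deriv_legendre_neq0 n : (0 < n)%N -> (legendre R n)^`() != 0.
Proof.
case: n => // n _; rewrite /legendre derivZ -derivnS scaler_eq0 negb_or.
rewrite invr_eq0 mulf_neq0 ?expf_neq0 ?pnatr_eq0 -?lt0n ?fact_gt0 //=.
have szq : size (('X^2 - 1) ^+ n.+1 : {poly R}) = (n.+2 + n).+1.
  have := size_exp ('X^2 - 1 : {poly R}) n.+1.
  rewrite size_XnsubC //= => sq.
  have q0 : (('X^2 - 1) ^+ n.+1 : {poly R}) != 0.
    by rewrite expf_neq0 // -size_poly_eq0 size_XnsubC.
  rewrite -[LHS]prednK ?lt0n ?size_poly_eq0 // sq; lia.
rewrite -!derivnS; apply/eqP => /(congr1 (fun r : {poly R} => r`_n)) /eqP.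
rewrite coef0 coef_derivn -mulr_natr mulf_eq0 pnatr_eq0 -leqn0 leqNgt.
rewrite ffact_gt0 leq_addr orbF -[(n.+2 + n)%N]/((n.+2 + n).+1.-1) -szq.
by rewrite -lead_coefE lead_coef_eq0 -size_poly_eq0 szq.
Qed.

Lemma size_legendre_le n : (size (legendre R n) <= n.+1)%N.
Proof.
rewrite /legendre (leq_trans (size_scale_leq _ _)) //.
apply/leq_sizeP => j nj; rewrite coef_derivn nth_default ?mul0rn //.
apply: leq_trans (size_poly_exp_leq _ _) _.
rewrite size_XnsubC //=; lia.
Qed.

End LegendreOrthogonality.

(** * Lagrange interpolation at distinct nodes *)

Section Interpolation.
Context {R : realType} {N : nat} (xi : 'I_N.+1 -> R).
Hypothesis xi_inj : injective xi.
Implicit Types (p q : {poly R}) (i j : 'I_N.+1).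

Lemma lagrange_poly_node j i : (lagrange_poly xi j).[xi i] = (i == j)%:R.
Proof.
rewrite /lagrange_poly horner_prod; case: (eqVneq i j) => [->|ij].
  rewrite big1 // => l lj; rewrite !hornerE mulVf // subr_eq0.
  by apply: contra_neq lj => /xi_inj.
by rewrite (bigD1 i) //= !hornerE subrr mulr0 mul0r.
Qed.

Lemma size_lagrange_poly j : (size (lagrange_poly xi j) <= N.+1)%N.
Proof.
rewrite /lagrange_poly scaler_prod; apply: leq_trans (size_scale_leq _ _) _.
have := size_prod_XsubC [seq l <- index_enum 'I_N.+1 | l != j] xi.
rewrite big_filter => ->; rewrite size_filter ltnS.
rewrite -[X in (_ <= X)%N]/(N.+1.-1) -[X in (_ <= X.-1)%N]card_ord -(cardC1 j).
by rewrite -sum1_count -sum1_card.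
Qed.

Lemma poly_eq_on_nodes p q : (size p <= N.+1)%N -> (size q <= N.+1)%N ->
  (forall i, p.[xi i] = q.[xi i]) -> p = q.
Proof.
move=> sp sq pq; apply/eqP; rewrite -subr_eq0; apply/eqP.
apply: (@roots_geq_poly_eq0 _ _ [seq xi i | i <- enum 'I_N.+1]).
- by apply/allP => _ /mapP[i _ ->]; rewrite rootE !hornerE pq subrr.
- by rewrite map_inj_uniq // enum_uniq.
- rewrite size_map size_enum_ord.
  by apply: leq_trans (size_polyD _ _) _; rewrite size_polyN geq_max sp sq.
Qed.

Lemma lagrange_interpolation p : (size p <= N.+1)%N ->
  p = \sum_i p.[xi i] *: lagrange_poly xi i.
Proof.
move=> sp; apply: poly_eq_on_nodes => // [|i].
  apply: (leq_trans (size_sum _ _ _)); apply/bigmax_leqP => i _.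
  exact: leq_trans (size_scale_leq _ _) (size_lagrange_poly i).
rewrite horner_sum (bigD1 i) //= hornerZ lagrange_poly_node eqxx mulr1.
rewrite big1 ?addr0 //.
by move=> j ji; rewrite hornerZ lagrange_poly_node eq_sym (negPf ji) mulr0.
Qed.


Lemma poly_int_lagrange p : (size p <= N.+1)%N ->
  poly_int p = \sum_i quad_weight xi i * p.[xi i].
Proof.
move=> sp; rewrite [in LHS](lagrange_interpolation p sp) poly_int_sum.
by apply: eq_bigr => i _; rewrite poly_intZ mulrC.
Qed.

End Interpolation.

(** * Exactness of Lobatto quadrature *)

Section LobattoQuadrature.
Context {R : realType} {N : nat} (xi : 'I_N.+1 -> R).
Hypotheses (N_gt0 : (0 < N)%N) (xi_lgl : lgl_points xi).
Implicit Types (p q : {poly R}) (i j : 'I_N.+1).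

Lemma lgl_points_inj : injective xi.
Proof.
case: xi_lgl => _ _ xi_lt _ i j eq_ij; apply/val_inj.
case: (ltngtP i j) => // /xi_lt; rewrite eq_ij ltxx //.
Qed.

Let nodal := \prod_i ('X - (xi i)%:P).
Let Lob := (('X^2 - 1) * (legendre R N)^`() : {poly R}).

Let sz_nodal : size nodal = N.+2.
Proof.
have := size_prod_XsubC (index_enum 'I_N.+1) xi.
by rewrite -/nodal => ->; rewrite -sum1_size sum1_card card_ord.
Qed.

(** The N+1 distinct nodes are all roots of [Lob]: the endpoints through [X^2 - 1], the others
    through the derivative of P_N. Hence [nodal] divides [Lob], and the degree bound N+1 leaves a
    constant quotient. *)
Lemma nodal_lobatto : exists2 c : R, c != 0 & Lob = c *: nodal.
Proof.
have [xi0 xiN _ xi_int] := xi_lgl.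
have Lob0 : Lob != 0.
  by rewrite mulf_neq0 ?deriv_legendre_neq0 // -size_poly_eq0 size_XnsubC.
have /dvdpP[q LobE] : nodal %| Lob.
  have := @uniq_roots_dvdp _ Lob [seq xi i | i <- enum 'I_N.+1].
  rewrite big_map big_enum /=; apply.
    apply/allP => _ /mapP[i _ ->]; rewrite rootE hornerM.
    have [->|i0] := eqVneq i ord0.
      by rewrite xi0 !hornerE; apply/eqP; ring.
    have [->|iN] := eqVneq i ord_max.
      by rewrite xiN !hornerE; apply/eqP; ring.
    by have /rootP -> := xi_int i i0 iN; rewrite mulr0.
  by rewrite uniq_rootsE map_inj_uniq ?enum_uniq //; exact: lgl_points_inj.
have q0 : q != 0 by apply: contra_neq Lob0 => q0; rewrite LobE q0 mul0r.
have szLob : (size Lob <= N.+2)%N.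
  apply: leq_trans (size_polyMleq _ _) _; rewrite size_XnsubC //=.
  rewrite add2n !ltnS; apply: leq_trans (leq_size_deriv _) _.
  by rewrite -subn1 leq_subLR add1n size_legendre_le.
have /size_poly1P[c c0 qc] : size q == 1%N.
  move: szLob; rewrite LobE size_mul // -?size_poly_eq0 ?sz_nodal //.
  by move: q0; rewrite -size_poly_eq0; case: (size q) => // n _; lia.
by exists c => //; rewrite LobE qc mul_polyC.
Qed.

(** Up to a constant, [nodal] is [X^2 - 1] times the derivative of P_N. Integration by parts frees
    P_N, the factor [X^2 - 1] removes the boundary terms, and what is tested against P_N has degree
    below N. *)
Lemma nodal_orthogonal q : (size q <= N.-1)%N -> poly_int (q * nodal) = 0.
Proof.
move=> sq; have [c c0 LobE] := nodal_lobatto.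
apply: (mulfI c0); rewrite mulr0 -poly_intZ scalerAr -LobE /Lob mulrA.
rewrite poly_int_by_parts legendre_orthogonal.
  by rewrite !hornerM !horner_sqrX_sub1 !mulr0 !mul0r !subrr.
apply: leq_trans (leq_size_deriv _) _; rewrite -subn1 leq_subLR.
by apply: leq_trans (size_polyMleq _ _) _; rewrite size_XnsubC //; lia.
Qed.

(** As for Gauss rules, divide by the nodal polynomial. The quotient part has zero integral by
    orthogonality and vanishes at the nodes; the remainder has degree at most N and equals its
    interpolant. *)
Lemma lobatto_exact p : (size p <= 2 * N)%N ->
  poly_int p = \sum_i quad_weight xi i * p.[xi i].
Proof.
move=> sp.
have nodal_monic : nodal \is monic by exact: monic_prod_XsubC.
have nodal0 : nodal != 0 by rewrite monic_neq0.
have sq : (size (p %/ nodal)%R <= N.-1)%N.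
  rewrite size_divp // sz_nodal leq_subLR; apply: leq_trans sp _; lia.
have sr : (size (p %% nodal)%R <= N.+1)%N.
  by rewrite -ltnS -sz_nodal ltn_modp.
rewrite [in LHS](divp_eq p nodal) poly_intD nodal_orthogonal // add0r.
rewrite (poly_int_lagrange _ lgl_points_inj) //; apply: eq_bigr => i _.
rewrite [in RHS](divp_eq p nodal) hornerD hornerM.
suff -> : nodal.[xi i] = 0 by rewrite mulr0 add0r.
by rewrite horner_prod (bigD1 i) //= hornerXsubC subrr mul0r.
Qed.

Lemma summation_by_parts i j :
  quad_weight xi i * diff_mx xi i j + quad_weight xi j * diff_mx xi j i =
  ((i == ord_max) && (j == ord_max))%:R - ((i == ord0) && (j == ord0))%:R.
Proof.
have xi_inj := lgl_points_inj; have [xi0 xiN _ _] := xi_lgl.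
pose l k := lagrange_poly xi k.
(* The integrand has degree at most 2N-1, so quadrature is exact, and [l a] keeps only the node
   [a]. *)
have quadM a b : quad_weight xi a * diff_mx xi a b = poly_int (l a * (l b)^`()).
  rewrite lobatto_exact.
    rewrite (bigD1 a) //= hornerM lagrange_poly_node // eqxx mul1r.
    rewrite big1 ?addr0 // => k ka.
    by rewrite hornerM lagrange_poly_node // (negPf ka) mul0r mulr0.
  have := size_lagrange_poly xi a; have := size_lagrange_poly xi b.
  have := leq_size_deriv (l b); have := size_polyMleq (l a) (l b)^`().
  by rewrite /l; lia.
rewrite !quadM poly_int_by_parts [(l i)^`() * _]mulrC subrK !hornerM.
have l1 k : (l k).[1] = (k == ord_max)%:R.
  by rewrite -[X in _.[X]]xiN lagrange_poly_node // eq_sym.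
have lN1 k : (l k).[-1] = (k == ord0)%:R.
  by rewrite -[X in _.[X]]xi0 lagrange_poly_node // eq_sym.
by rewrite !l1 !lN1 -!natrM !mulnb.
Qed.

(** The Lagrange polynomials sum to the constant 1, whose derivative is zero. *)
Lemma sum_diff_mx i : \sum_j diff_mx xi i j = 0.
Proof.
have := lagrange_interpolation xi lgl_points_inj 1.
rewrite size_poly1 => /(_ isT) /(congr1 (fun p => p^`().[xi i])).
rewrite -[X in X^`().[_]]/(1%:P) derivC horner0 => /esym E.
rewrite -[RHS]E raddf_sum horner_sum.
by apply: eq_bigr => j _; rewrite /= derivZ !hornerE.
Qed.

End LobattoQuadrature.

(** * Entropy variables and two-point fluxes *)

Section EntropyVariables.
Context {R : realType}.
Implicit Types (L Q U : 'rV[R]_4).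

Lemma gamma1_neq0 : (gamma - 1 : R) != 0.
Proof. rewrite /gamma; apply/eqP; lra. Qed.

Lemma sum4 (F : 'I_4 -> R) : \sum_k F k = F 0 + F 1 + F 2 + F 3.
Proof.
rewrite !big_ord_recr big_ord0 /= add0r.
by congr (F _ + F _ + F _ + F _); apply: val_inj.
Qed.

(* Closed form of the gradient of the entropy at an admissible state. *)
Definition entropy_row U : 'rV[R]_4 :=
  let s := ln (pressure U * rho U `^ (- gamma)) in
  let b := beta U in
  row4 ((gamma - s) / (gamma - 1) - b * (velx U ^+ 2 + vely U ^+ 2))
    (2 * b * velx U) (2 * b * vely U) (- (2 * b)).

Lemma row40 (a b c d : R) : row4 a b c d 0 0 = a. Proof. by rewrite mxE. Qed.
Lemma row41 (a b c d : R) : row4 a b c d 0 1 = b. Proof. by rewrite mxE. Qed.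
Lemma row42 (a b c d : R) : row4 a b c d 0 2 = c. Proof. by rewrite mxE. Qed.
Lemma row43 (a b c d : R) : row4 a b c d 0 3 = d. Proof. by rewrite mxE. Qed.
Definition row4E := (row40, row41, row42, row43).

Lemma is_derive_congr (f g : R -> R) (t d d' : R) :
  is_derive t 1 f d -> f =1 g -> d = d' -> is_derive t 1 g d'.
Proof. by move=> df /funext <- <-. Qed.

(* Differentiating along an arbitrary curve covers both the partial derivatives
   (lines in a coordinate direction) and the time derivative of a nodal state. *)
Lemma is_derive_entropy (c : R -> 'rV[R]_4) (dc : 'rV[R]_4) (t : R) :
  admissible (c t) -> (forall k, is_derive t 1 (fun s => c s 0 k) (dc 0 k)) ->
  is_derive t 1 (fun s => entropy (c s)) (\sum_k entropy_row (c t) 0 k * dc 0 k).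
Proof.
move=> [r_gt0 p_gt0] dck.
have r0 : rho (c t) != 0 by rewrite gt_eqF.
have p0 : pressure (c t) != 0 by rewrite gt_eqF.
have g0 := gamma1_neq0.
have dr : is_derive t 1 (fun s => rho (c s)) (dc 0 0) := dck 0.
have dri := is_deriveV r0 dr.
have du : is_derive t 1 (fun s => velx (c s))
    ((dc 0 1 - velx (c t) * dc 0 0) / rho (c t)).
  apply: (is_derive_congr _ _ _ _ _ (is_deriveM (dck 1) dri)) => //.
  by rewrite /GRing.scale /= /velx; field.
have dv : is_derive t 1 (fun s => vely (c s))
    ((dc 0 2 - vely (c t) * dc 0 0) / rho (c t)).
  apply: (is_derive_congr _ _ _ _ _ (is_deriveM (dck 2) dri)) => //.
  by rewrite /GRing.scale /= /vely; field.
(* The gradient of the pressure in conserved variables, paired with [dc]. *)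
pose dp : R := (gamma - 1) * (dc 0 3 - velx (c t) * dc 0 1 - vely (c t) * dc 0 2
  + 2^-1 * (velx (c t) ^+ 2 + vely (c t) ^+ 2) * dc 0 0).
have dpP : is_derive t 1 (fun s => pressure (c s)) dp.
  have dhr : is_derive t 1 (fun s => 2^-1 * rho (c s)) (2^-1 * dc 0 0) :=
    is_deriveZ _ dr.
  have dsq : is_derive t 1
      (fun s => velx (c s) * velx (c s) + vely (c s) * vely (c s)) _ :=
    is_deriveD (is_deriveM du du) (is_deriveM dv dv).
  have dq := is_deriveB (dck 3) (is_deriveM dhr dsq).
  apply: (is_derive_congr _ _ _ _ _ (is_deriveZ (gamma - 1) dq)) => [s|].
    by rewrite /pressure /energy !expr2.
  by rewrite /GRing.scale /= /dp; field.
have dln : is_derive t 1 (fun s => ln (pressure (c s) * rho (c s) `^ (- gamma)))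
    (dp / pressure (c t) - gamma * dc 0 0 / rho (c t)).
  have dpw := @is_derive1_comp R (@powR R ^~ (- gamma)) _ _ _ _
    (is_derive1_powR (- gamma) r_gt0) dr.
  have w_gt0 : 0 < pressure (c t) * rho (c t) `^ (- gamma).
    by rewrite mulr_gt0 ?powR_gt0.
  pose z s := pressure (c s) * rho (c s) `^ (- gamma).
  have dpM : is_derive t 1 z _ := is_deriveM dpP dpw.
  have dl := @is_derive1_comp R (@ln R) z t _ _ (is_derive1_ln w_gt0) dpM.
  apply: (is_derive_congr _ _ _ _ _ dl) => //.
  rewrite /GRing.scale /= powRB ?r0 ?implybT // powRr1; last exact: ltW.
  have : rho (c t) `^ (- gamma) != 0 by rewrite gt_eqF ?powR_gt0.
  move: (_ `^ _) => w w0; field; by rewrite ?w0 ?r0 ?p0.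
have drl : is_derive t 1
    (fun s => rho (c s) * ln (pressure (c s) * rho (c s) `^ (- gamma))) _ :=
  is_deriveM dr dln.
have dS : is_derive t 1 (fun s => - (gamma - 1)^-1 *
    (rho (c s) * ln (pressure (c s) * rho (c s) `^ (- gamma)))) _ :=
  is_deriveZ _ drl.
apply: (is_derive_congr _ _ _ _ _ dS) => [s|].
  by rewrite /entropy !mulNr [X in - X = _]mulrC.
rewrite sum4 /entropy_row !row4E /GRing.scale /= /dp /beta.
move: (dc 0 0) (dc 0 1) (dc 0 2) (dc 0 3) (velx _) (vely _) => d0 d1 d2 d3 u v.
move: (gamma : R) g0 (rho _) r0 (pressure _) p0 (ln _) => g g0 r r0 p p0 w.
by field; rewrite r0 p0 g0.
Qed.

Lemma entropy_varE U k : admissible U -> entropy_var U k = entropy_row U 0 k.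
Proof.
(* The partial derivative is the derivative at 0 along the coordinate line through [U]. *)
move=> admU; pose c (s : R) := U + s *: (delta_mx 0 k : 'rV[R]_4).
have c0 : c 0 = U by rewrite /c scale0r addr0.
have dc j : is_derive (0 : R) (1 : R) (fun s => c s 0 j)
    ((delta_mx 0 k : 'rV[R]_4) 0 j).
  rewrite [X in is_derive _ _ X _](_ : _ = cst (U 0 j)
      \+ (fun s => s * (delta_mx 0 k : 'rV[R]_4) 0 j)).
    by apply: is_derive_eq; rewrite scaler0 !add0r /GRing.scale /= mulr1.
  by apply/funext => s; rewrite !mxE.
have admc : admissible (c 0) by rewrite c0.
have := @derive_val _ _ _ _ _ _ _ (is_derive_entropy _ _ _ admc dc).
rewrite c0 (bigD1 k) //= [delta_mx _ _ _ _]mxE !eqxx mulr1 big1 ?addr0; last first.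
  by move=> j jk; rewrite [delta_mx _ _ _ _]mxE (negPf jk) andbF mulr0.
move=> <-; rewrite /entropy_var /derive /=.
have -> : (fun h : R => h^-1 *: (entropy (c (h *: 1 + 0)) - entropy (c 0))) =
    (fun h : R => h^-1 *:
       (entropy (h *: (delta_mx 0 k : 'rV[R]_4) + U) - entropy U)).
  by apply/funext => h; rewrite c0 /c addr0 [h *: 1]mulr1 [U + _]addrC.
reflexivity.
Qed.

(** The chain rule that links the entropy rate at a node to the scheme tested with the entropy
    variables. *)
Lemma derive1_entropy (c : R -> 'rV[R]_4) (t : R) :
  admissible (c t) -> (forall k, derivable (fun s : R => c s 0 k) t 1) ->
  derive1 (fun s => entropy (c s)) t =
  \sum_k entropy_var (c t) k * derive1 (fun s => c s 0 k) t.
Proof.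
move=> admc dc; pose d := \row_k derive1 (fun s => c s 0 k) t : 'rV[R]_4.
rewrite derive1E.
rewrite (@derive_val _ _ _ _ _ _ _ (is_derive_entropy c d t admc _)).
  by apply: eq_bigr => k _; rewrite entropy_varE // [d _ _]mxE.
by move=> k; rewrite mxE derive1E; exact: derivableP.
Qed.

End EntropyVariables.

(** * Symmetry, consistency and entropy conservation of the two-point fluxes *)

Section TwoPointFlux.
Context {R : realType}.
Implicit Types (L Q U : 'rV[R]_4) (a b : R).

Lemma avgC a b : avg a b = avg b a.
Proof. by rewrite /avg addrC. Qed.

Lemma avgxx a : avg a a = a.
Proof. by rewrite /avg; field. Qed.

Lemma logmeanC a b : logmean a b = logmean b a.
Proof.
rewrite /logmean eq_sym; case: eqVneq => // _.
by rewrite -[a - b]opprB -[ln a - ln b]opprB invrN mulrNN.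
Qed.

(** Stated without division, the defining property also covers [a = b], so jumps of logarithms can
    be handled without a case split. *)
Lemma logmean_mul a b : 0 < a -> 0 < b -> logmean a b * (ln a - ln b) = a - b.
Proof.
move=> a0 b0; rewrite /logmean.
case: eqVneq => [->|ab]; first by rewrite !subrr mulr0.
rewrite divfK // subr_eq0; apply: contra_neq ab => /ln_inj; apply; exact.
Qed.

Lemma logmean_neq0 a b : 0 < a -> 0 < b -> logmean a b != 0.
Proof.
move=> a0 b0; have := logmean_mul _ _ a0 b0; rewrite /logmean.
case: eqVneq => [_ _|ab E]; first by rewrite gt_eqF.
apply: contra_neq ab => l0; move: E.
by rewrite l0 mul0r => /esym/eqP; rewrite subr_eq0 => /eqP.
Qed.

Lemma fsharpC L Q : fsharp L Q = fsharp Q L.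
Proof.
rewrite /fsharp /hhat /phat (logmeanC (rho L)) (logmeanC (beta L)).
rewrite (avgC (velx L)) (avgC (vely L)) (avgC (velx L ^+ 2)).
by rewrite (avgC (vely L ^+ 2)) (avgC (rho L)) (avgC (beta L)).
Qed.

Lemma gsharpC L Q : gsharp L Q = gsharp Q L.
Proof.
rewrite /gsharp /hhat /phat (logmeanC (rho L)) (logmeanC (beta L)).
rewrite (avgC (velx L)) (avgC (vely L)) (avgC (velx L ^+ 2)).
by rewrite (avgC (vely L ^+ 2)) (avgC (rho L)) (avgC (beta L)).
Qed.

Lemma energyE U : energy U = pressure U / (gamma - 1)
     + 2^-1 * rho U * (velx U ^+ 2 + vely U ^+ 2).
Proof. by rewrite /pressure mulrC mulKf ?gamma1_neq0 // subrK. Qed.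

Lemma hhat_consistent U : admissible U ->
  rho U * hhat U U = energy U + pressure U.
Proof.
move=> [/lt0r_neq0 r0 /lt0r_neq0 p0].
rewrite energyE /hhat /phat /logmean !eqxx !avgxx /beta.
move: (gamma1_neq0 (R := R)) r0 p0.
move: (gamma - 1 : R) (rho U) (pressure U) (velx U) (vely U).
move=> g r p u v g0 r0 p0.
by field; rewrite r0 p0 g0.
Qed.

Lemma phat_consistent U : admissible U -> phat U U = pressure U.
Proof.
move=> [/lt0r_neq0 r0 /lt0r_neq0 p0]; rewrite /phat !avgxx /beta.
by move: (rho U) (pressure U) r0 p0 => r p r0 p0; field; rewrite r0 p0.
Qed.

(** Consistency makes the corner terms left by summation by parts equal to the nodal fluxes in the
    surface terms of the scheme. *)
Lemma fsharp_consistent U : admissible U -> fsharp U U = flux_f U.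
Proof.
move=> admU; rewrite /fsharp /flux_f phat_consistent // /logmean eqxx !avgxx.
by rewrite [rho U * velx U * hhat _ _]mulrAC hhat_consistent.
Qed.

Lemma gsharp_consistent U : admissible U -> gsharp U U = flux_g U.
Proof.
move=> admU; rewrite /gsharp /flux_g phat_consistent // /logmean eqxx !avgxx.
by rewrite [rho U * vely U * hhat _ _]mulrAC hhat_consistent.
Qed.

Lemma beta_gt0 U : admissible U -> 0 < beta U.
Proof. by move=> [r0 p0]; rewrite divr_gt0 // mulr_gt0 // ltr0n. Qed.

(** Substituting p = rho / (2 beta) expresses the entropy by the logarithms of rho and beta, the two
    quantities whose logarithmic means enter the flux. *)
Lemma ln_specific_entropy U : admissible U ->
  ln (pressure U * rho U `^ (- gamma)) =
  - (gamma - 1) * ln (rho U) - ln (beta U) - ln 2.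
Proof.
move=> [r0 p0]; have p2 : 0 < 2 * pressure U by rewrite mulr_gt0.
rewrite /beta lnM ?posrE ?powR_gt0 // ln_powR ln_div ?posrE //.
rewrite [ln (2 * _)]lnM ?posrE //; ring.
Qed.

(* [A], [P] and [H] stand for the jump of [V_1], for [phat] and for the first
   term of [hhat]. *)
Lemma entropy_flux_identity (rL rQ bL bQ uL uQ vL vQ r P A H : R)
    (u := avg uL uQ) (v := avg vL vQ)
    (k := avg (uL ^+ 2) (uQ ^+ 2) + avg (vL ^+ 2) (vQ ^+ 2)) :
  r * A = rL - rQ + r * (2 * (bL - bQ) * H)
    - r * (bL * (uL ^+ 2 + vL ^+ 2) - bQ * (uQ ^+ 2 + vQ ^+ 2)) ->
  P * (bL + bQ) = 2^-1 * (rL + rQ) ->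
  A * (r * u) + (2 * bL * uL - 2 * bQ * uQ) * (r * u ^+ 2 + P)
    + (2 * bL * vL - 2 * bQ * vQ) * (r * u * v)
    + (- (2 * bL) - - (2 * bQ)) * (u * (r * (H - 2^-1 * k + u ^+ 2 + v ^+ 2) + P))
  = rL * uL - rQ * uQ.
Proof.
move=> rA PE; apply/eqP; rewrite -subr_eq0; apply/eqP.
(* Once [rA] has eliminated [A], all that remains is the jump of [u] times the defect in the
   hypothesis on [P]. *)
transitivity ((uL - uQ) * (P * (bL + bQ) - 2^-1 * (rL + rQ))); last first.
  by rewrite PE subrr mulr0.
rewrite (_ : A * (r * u) = r * A * u); last by ring.
by rewrite rA /k /u /v /avg; field.
Qed.

(** The factor [r] turns the jump of ln rho into that of rho. The jump of ln beta is the jump of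
    beta over its logarithmic mean, which produces the first term of [hhat]. *)
Lemma entropy_row_jump0 L Q (r := logmean (rho L) (rho Q)) :
  admissible L -> admissible Q ->
  r * (entropy_row L 0 0 - entropy_row Q 0 0) = rho L - rho Q
    + r * (2 * (beta L - beta Q) *
           (1 / (2 * logmean (beta L) (beta Q) * (gamma - 1))))
    - r * (beta L * (velx L ^+ 2 + vely L ^+ 2)
           - beta Q * (velx Q ^+ 2 + vely Q ^+ 2)).
Proof.
move=> admL admQ; have [rL pL] := admL; have [rQ pQ] := admQ.
have bL := beta_gt0 _ admL; have bQ := beta_gt0 _ admQ.
rewrite /entropy_row !row4E !ln_specific_entropy // -(logmean_mul _ _ rL rQ).
rewrite -(logmean_mul _ _ bL bQ) /r.
have := logmean_neq0 _ _ bL bQ; have := gamma1_neq0 (R := R).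
move: (logmean _ _) (logmean _ _) (ln _) (ln _) (ln _) (ln _) (ln _) (gamma : R).
move: (beta L * _) (beta Q * _).
move=> kL kQ lr lb xL yL x2 xQ yQ g g0 lb0.
by field; rewrite g0 lb0.
Qed.

Lemma entropy_conservative_flux L Q : admissible L -> admissible Q ->
  \sum_k (entropy_row L 0 k - entropy_row Q 0 k) * fsharp L Q 0 k
    = psi_f L - psi_f Q /\
  \sum_k (entropy_row L 0 k - entropy_row Q 0 k) * gsharp L Q 0 k
    = psi_g L - psi_g Q.
Proof.
move=> admL admQ; have rA := entropy_row_jump0 _ _ admL admQ.
have bL := beta_gt0 _ admL; have bQ := beta_gt0 _ admQ.
have r0 : logmean (rho L) (rho Q) != 0.
  by apply: logmean_neq0; [case: admL | case: admQ].
have PE : phat L Q * (beta L + beta Q) = 2^-1 * (rho L + rho Q).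
  rewrite /phat /avg mulVKf ?pnatr_eq0 // divfK //.
  by rewrite gt_eqF // addr_gt0.
have [V1 V2 V3] : [/\ forall U, entropy_row U 0 1 = 2 * beta U * velx U,
    forall U, entropy_row U 0 2 = 2 * beta U * vely U
    & forall U, entropy_row U 0 3 = - (2 * beta U)].
  by split=> U; rewrite mxE.
rewrite !sum4 !V1 !V2 !V3.
move: (entropy_row L 0 0) (entropy_row Q 0 0) rA => aL aQ rA.
rewrite /fsharp /gsharp !row4E.
(* The factor [r] cancels the denominator under [phat], giving the shape used in
   [entropy_flux_identity]. *)
have hE : logmean (rho L) (rho Q) * hhat L Q = logmean (rho L) (rho Q) *
    (1 / (2 * logmean (beta L) (beta Q) * (gamma - 1))
     - 2^-1 * (avg (velx L ^+ 2) (velx Q ^+ 2)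
               + avg (vely L ^+ 2) (vely Q ^+ 2))
     + avg (velx L) (velx Q) ^+ 2 + avg (vely L) (vely Q) ^+ 2) + phat L Q.
  rewrite -[X in _ = _ + X](divfK r0) /hhat; ring.
split.
  rewrite -(entropy_flux_identity _ _ _ _ _ _ _ _ _ _ _ _ rA PE) -hE; ring.
(* The second flux is the first with the velocity components exchanged, so the same identity applies
   after reordering the sums of squares. *)
move: rA hE; rewrite [velx L ^+ 2 + _]addrC [velx Q ^+ 2 + _]addrC => rA hE.
rewrite -(entropy_flux_identity _ _ _ _ _ _ _ _ _ _ _ _ rA PE).
rewrite [avg (vely L ^+ 2) _ + _]addrC.
rewrite [_ + _ ^+ 2 + avg (velx L) _ ^+ 2]addrAC -hE; ring.
Qed.

End TwoPointFlux.

(** * Flux differencing *)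

Section LineDifferencing.
Context {R : realType} {N : nat}.
Context (w : 'I_N.+1 -> R) (D : 'I_N.+1 -> 'I_N.+1 -> R).
Hypothesis sbp : forall i j, w i * D i j + w j * D j i =
  ((i == ord_max) && (j == ord_max))%:R - ((i == ord0) && (j == ord0))%:R.
Hypothesis sumD : forall i, \sum_j D i j = 0.

Lemma sum_mul_delta (F : 'I_N.+1 -> R) i : \sum_j F j * (j == i)%:R = F i.
Proof.
rewrite (bigD1 i) //= eqxx mulr1 big1 ?addr0 // => j /negPf ->.
by rewrite mulr0.
Qed.

Lemma sbp_split (H : 'I_N.+1 -> 'I_N.+1 -> R) :
  2 * (\sum_i \sum_j w i * D i j * H i j) =
  H ord_max ord_max - H ord0 ord0 + \sum_i \sum_j w i * D i j * (H i j - H j i).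
Proof.
(* Corner values become double sums, which reduces the claim to [sbp] at each pair of indices. *)
have corner l : \sum_i \sum_j ((i == l) && (j == l))%:R * H j i = H l l.
  rewrite -[RHS](sum_mul_delta (fun i => H l i)); apply: eq_bigr => i _.
  rewrite -(sum_mul_delta (fun j => H j i)) mulr_suml; apply: eq_bigr => j _.
  by rewrite -mulnb natrM; ring.
rewrite -!corner mulr2n mulrDl mul1r {2}exchange_big -sumrB -!big_split /=.
apply: eq_bigr => i _; rewrite -sumrB -!big_split /=; apply: eq_bigr => j _.
by rewrite -mulrBl -sbp; ring.
Qed.

Lemma sbp_symmetric (F : 'I_N.+1 -> 'I_N.+1 -> R) :
  (forall i j, F i j = F j i) ->
  \sum_i w i * (2 * \sum_j D i j * F j i) = F ord_max ord_max - F ord0 ord0.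
Proof.
move=> FC; have := sbp_split F.
rewrite [X in _ + X]big1 ?addr0 => [<-|i _]; last first.
  by rewrite big1 // => j _; rewrite FC subrr mulr0.
rewrite mulr_sumr; apply: eq_bigr => i _.
rewrite !mulr_sumr; apply: eq_bigr => j _; rewrite (FC j i); ring.
Qed.

(** Split the average multiplying [psi i]: the [a i] half vanishes because the rows of [D] sum to
    zero, and the [a j] half gives the discrete derivative of [a]. [sbp_split] then yields the jump
    form. *)
Lemma sbp_jump (a psi : 'I_N.+1 -> R) :
  \sum_i \sum_j w i * D i j * (avg (a i) (a j) * (psi i - psi j)) =
  \sum_i w i * (psi i * \sum_j D i j * a j)
  - a ord_max * psi ord_max + a ord0 * psi ord0.
Proof.
have := sbp_split (fun i j => avg (a i) (a j) * psi i); rewrite /= !avgxx.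
have -> : 2 * (\sum_i \sum_j w i * D i j * (avg (a i) (a j) * psi i)) =
    \sum_i w i * (psi i * \sum_j D i j * a j).
  rewrite mulr_sumr; apply: eq_bigr => i _.
  transitivity (w i * (psi i * \sum_j D i j * a j)
                + w i * psi i * a i * \sum_j D i j).
    rewrite !mulr_sumr -big_split /=; apply: eq_bigr => j _.
    by rewrite /avg; field.
  by rewrite sumD mulr0 addr0.
have cancel (u v s : R) : u - v + s - u + v = s by ring.
move=> ->; rewrite cancel; apply: eq_bigr => i _; apply: eq_bigr => j _.
by rewrite (avgC (a j)) -mulrBr.
Qed.

(* [(a, b)] is [(y_eta, - x_eta)] on xi-lines, [(- y_xi, x_xi)] on eta-lines. *)
Definition line_flux (a b a' b' : R) (L Q : 'rV[R]_4) : 'rV[R]_4 :=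
  avg a a' *: fsharp L Q + avg b b' *: gsharp L Q.

Lemma line_fluxC (a b a' b' : R) L Q :
  line_flux a b a' b' L Q = line_flux a' b' a b Q L.
Proof. by rewrite /line_flux fsharpC gsharpC (avgC a) (avgC b). Qed.

Lemma line_flux_consistent (a b : R) Q : admissible Q ->
  line_flux a b a b Q Q = a *: flux_f Q + b *: flux_g Q.
Proof.
by move=> admQ; rewrite /line_flux !avgxx fsharp_consistent ?gsharp_consistent.
Qed.

(** [F], [ct] and [pot] are fixed only through their values, so that one argument serves grid lines
    in both directions. *)
Context (a b : 'I_N.+1 -> R) (U : 'I_N.+1 -> 'rV[R]_4).
Hypothesis admU : forall i, admissible (U i).
Context (F : 'I_N.+1 -> 'I_N.+1 -> 'I_4 -> R) (ct : 'I_N.+1 -> 'I_4 -> R)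
  (pot : 'I_N.+1 -> R).
Hypothesis FE : forall i j k,
  F i j k = line_flux (a i) (b i) (a j) (b j) (U i) (U j) 0 k.
Hypothesis ctE : forall i k,
  ct i k = (a i *: flux_f (U i) + b i *: flux_g (U i)) 0 k.
Hypothesis potE : forall i, pot i = a i * psi_f (U i) + b i * psi_g (U i).
Let V i k := entropy_var (U i) k.

Let FC i j k : F i j k = F j i k.
Proof. by rewrite !FE line_fluxC. Qed.

Let Fii i k : F i i k = ct i k.
Proof. by rewrite FE ctE line_flux_consistent. Qed.

Lemma line_conservation k :
  \sum_i w i * (2 * \sum_j D i j * F j i k) = ct ord_max k - ct ord0 k.
Proof. by rewrite (sbp_symmetric (fun i j => F i j k)) ?Fii. Qed.

(** By symmetry of [F], the antisymmetric part left by [sbp_split] pairs the jump of [V] with the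
    flux, which is the jump of the potentials weighted by averaged metric terms; [sbp_jump]
    evaluates it. *)
Lemma line_entropy :
  \sum_i w i * (\sum_k V i k * (2 * \sum_j D i j * F j i k)) =
  (\sum_k V ord_max k * ct ord_max k - pot ord_max)
  - (\sum_k V ord0 k * ct ord0 k - pot ord0)
  + \sum_i w i * (psi_f (U i) * (\sum_j D i j * a j)
                  + psi_g (U i) * (\sum_j D i j * b j)).
Proof.
have jump i j : \sum_k V i k * F i j k - \sum_k V j k * F j i k =
    avg (a i) (a j) * (psi_f (U i) - psi_f (U j))
    + avg (b i) (b j) * (psi_g (U i) - psi_g (U j)).
  have [<- <-] := entropy_conservative_flux _ _ (admU i) (admU j).
  rewrite !mulr_sumr -sumrB -big_split /=; apply: eq_bigr => k _.
  by rewrite (FC j i) FE /V !entropy_varE // /line_flux !mxE; ring.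
have -> : \sum_i w i * (\sum_k V i k * (2 * \sum_j D i j * F j i k)) =
    2 * \sum_i \sum_j w i * D i j * \sum_k V i k * F i j k.
  rewrite mulr_sumr; apply: eq_bigr => i _.
  under eq_bigr do rewrite mulrCA mulr_sumr.
  rewrite -mulr_sumr exchange_big /= mulrCA; congr (2 * _).
  rewrite mulr_sumr; apply: eq_bigr => j _; rewrite -mulrA; congr (w i * _).
  by rewrite mulr_sumr; apply: eq_bigr => k _; rewrite (FC j i); ring.
rewrite sbp_split !potE.
under [X in _ + X = _]eq_bigr do under eq_bigr do rewrite jump mulrDr.
under [X in _ + X = _]eq_bigr do rewrite big_split.
rewrite big_split /= !sbp_jump.
under [X in _ = _ + X]eq_bigr do rewrite mulrDr.
rewrite big_split /=.
under eq_bigr do rewrite Fii.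
under [X in _ - X + _ = _]eq_bigr do rewrite Fii.
ring.
Qed.

(** The interior fluxes [ct] of the surface terms cancel those of [line_entropy], leaving only the
    numerical fluxes [s0] and [sN]. The factor [c] is the weight in the transverse direction. *)
Lemma line_entropy_surface (c : R) (s0 sN : 'I_4 -> R) :
  \sum_k c * (V ord0 k * (s0 k - ct ord0 k) - V ord_max k * (sN k - ct ord_max k)
              - \sum_i w i * (V i k * (2 * \sum_j D i j * F j i k))) =
  c * (\sum_k s0 k * V ord0 k - pot ord0)
  - c * (\sum_k sN k * V ord_max k - pot ord_max)
  - c * \sum_i w i * (psi_f (U i) * (\sum_j D i j * a j)
                      + psi_g (U i) * (\sum_j D i j * b j)).
Proof.
have surf l (s : 'I_4 -> R) : \sum_k V l k * (s k - ct l k) =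
    \sum_k s k * V l k - \sum_k V l k * ct l k.
  by rewrite -sumrB; apply: eq_bigr => k _; ring.
rewrite -mulr_sumr -!mulrBr !sumrB !surf exchange_big /=; congr (c * _).
under [X in _ - X = _]eq_bigr do rewrite -mulr_sumr.
have regroup (x0 xN y0 yN p0 pN z : R) :
    x0 - y0 - (xN - yN) - (yN - pN - (y0 - p0) + z)
    = x0 - p0 - (xN - pN) - z by ring.
by rewrite line_entropy regroup.
Qed.

End LineDifferencing.

(** * The scheme tested with nodal functions: conservation and entropy balance *)

Section TestedScheme.
Context {R : realType} {N : nat} (xi : 'I_N.+1 -> R).
Context (m : 'I_N.+1 -> 'I_N.+1 -> metric R).
Context (U dU : 'I_N.+1 -> 'I_N.+1 -> 'rV[R]_4).
Context (fstar gstar : bool -> 'I_N.+1 -> 'rV[R]_4).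
Notation w := (quad_weight xi).
Notation D := (diff_mx xi).

Lemma dgsem_tested (W : 'I_N.+1 -> 'I_N.+1 -> R) k :
  dgsem xi m U dU fstar gstar ->
  \sum_i \sum_j w i * w j * jac_det (m i j) * dU i j 0 k * W i j =
  \sum_j w j *
    (W ord0 j * (fstar false j 0 k - ct_f (m ord0 j) (U ord0 j) 0 k)
     - W ord_max j * (fstar true j 0 k - ct_f (m ord_max j) (U ord_max j) 0 k)
     - \sum_i w i * (W i j * (2 * \sum_p D i p *
         ct_fsharp (m p j) (m i j) (U p j) (U i j) 0 k)))
  + \sum_i w i *
    (W i ord0 * (gstar false i 0 k - ct_g (m i ord0) (U i ord0) 0 k)
     - W i ord_max * (gstar true i 0 k - ct_g (m i ord_max) (U i ord_max) 0 k)
     - \sum_j w j * (W i j * (2 * \sum_p D j p *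
         ct_gsharp (m i p) (m i j) (U i p) (U i j) 0 k))).
Proof.
move=> dg.
pose A i j := 2 * \sum_p D i p * ct_fsharp (m p j) (m i j) (U p j) (U i j) 0 k.
pose B i j := 2 * \sum_p D j p * ct_gsharp (m i p) (m i j) (U i p) (U i j) 0 k.
pose f0 j := fstar false j 0 k - ct_f (m ord0 j) (U ord0 j) 0 k.
pose fN j := fstar true j 0 k - ct_f (m ord_max j) (U ord_max j) 0 k.
pose g0 i := gstar false i 0 k - ct_g (m i ord0) (U i ord0) 0 k.
pose gN i := gstar true i 0 k - ct_g (m i ord_max) (U i ord_max) 0 k.
have node_eq i j : w i * w j * jac_det (m i j) * dU i j 0 k * W i j =
    w j * (W i j * f0 j * (i == ord0)%:R - W i j * fN j * (i == ord_max)%:R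
           - w i * (W i j * A i j))
    + w i * (W i j * g0 i * (j == ord0)%:R - W i j * gN i * (j == ord_max)%:R
           - w j * (W i j * B i j)).
  apply/eqP; rewrite -subr_eq0; apply/eqP.
  (* The difference of the two sides is [W i j] times the left side of the scheme. *)
  rewrite -[RHS](mulr0 (W i j)) -[in RHS](dg i j k) /A /B /f0 /fN /g0 /gN.
  ring.
under eq_bigr do under eq_bigr do rewrite node_eq.
under eq_bigr do rewrite big_split.
rewrite big_split /= exchange_big /=; congr (_ + _); apply: eq_bigr => i _.
  rewrite -mulr_sumr !sumrB; congr (_ * (_ - _ - _)).
    exact: (sum_mul_delta (fun l => W l i * f0 i)).
  exact: (sum_mul_delta (fun l => W l i * fN i)).
rewrite -mulr_sumr !sumrB; congr (_ * (_ - _ - _)).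
  exact: (sum_mul_delta (fun l => W i l * g0 i)).
exact: (sum_mul_delta (fun l => W i l * gN i)).
Qed.

Hypotheses (N_gt0 : (0 < N)%N) (xi_lgl : lgl_points xi).
Hypothesis admU : forall i j, admissible (U i j).

(** Line data for the preceding section: [_xi] fixes the second index and varies the first, [_eta]
    the reverse. *)
Let a_xi j p := m_yeta (m p j).
Let b_xi j p := - m_xeta (m p j).
Let F_xi j p q k := ct_fsharp (m p j) (m q j) (U p j) (U q j) 0 k.
Let ct_xi j p k := ct_f (m p j) (U p j) 0 k.
Let pot_xi j p := ct_psi_f (m p j) (U p j).

Let F_xiE j p q k : F_xi j p q k =
  line_flux (a_xi j p) (b_xi j p) (a_xi j q) (b_xi j q) (U p j) (U q j) 0 k.
Proof.
by rewrite /F_xi /ct_fsharp /line_flux /b_xi /avg -opprD mulrN scaleNr.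
Qed.

Let ct_xiE j p k :
  ct_xi j p k = (a_xi j p *: flux_f (U p j) + b_xi j p *: flux_g (U p j)) 0 k.
Proof. by rewrite /ct_xi /ct_f scaleNr. Qed.

Let pot_xiE j p :
  pot_xi j p = a_xi j p * psi_f (U p j) + b_xi j p * psi_g (U p j).
Proof. by rewrite /pot_xi /ct_psi_f mulNr. Qed.

Let a_eta i p := - m_yxi (m i p).
Let b_eta i p := m_xxi (m i p).
Let F_eta i p q k := ct_gsharp (m i p) (m i q) (U i p) (U i q) 0 k.
Let ct_eta i p k := ct_g (m i p) (U i p) 0 k.
Let pot_eta i p := ct_psi_g (m i p) (U i p).

Let F_etaE i p q k : F_eta i p q k =
  line_flux (a_eta i p) (b_eta i p) (a_eta i q) (b_eta i q) (U i p) (U i q) 0 k.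
Proof. by rewrite /F_eta /ct_gsharp /line_flux /a_eta /avg -opprD mulrN. Qed.

Lemma dgsem_conservation k : dgsem xi m U dU fstar gstar ->
  \sum_i \sum_j w i * w j * jac_det (m i j) * dU i j 0 k =
  \sum_i w i * (gstar false i 0 k - gstar true i 0 k)
  + \sum_j w j * (fstar false j 0 k - fstar true j 0 k).
Proof.
move=> dg; have sbp := summation_by_parts xi N_gt0 xi_lgl.
transitivity (\sum_i \sum_j w i * w j * jac_det (m i j) * dU i j 0 k * 1).
  by apply: eq_bigr => i _; apply: eq_bigr => j _; rewrite mulr1.
rewrite (dgsem_tested (fun _ _ => 1)) // addrC; congr (_ + _).
  apply: eq_bigr => i _; congr (_ * _); under eq_bigr do rewrite mul1r.
  rewrite (line_conservation _ _ sbp (a_eta i) (b_eta i) (U i) (admU i)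
    (F_eta i) (ct_eta i) (F_etaE i)) // /ct_eta; ring.
apply: eq_bigr => j _; congr (_ * _); under eq_bigr do rewrite mul1r.
rewrite (line_conservation _ _ sbp (a_xi j) (b_xi j) (U^~ j) (admU^~ j)
  (F_xi j) (ct_xi j) (F_xiE j) (ct_xiE j)) /ct_xi; ring.
Qed.

Lemma dgsem_entropy : discrete_metric_identities xi m ->
  dgsem xi m U dU fstar gstar ->
  \sum_i \sum_j w i * w j * jac_det (m i j)
     * (\sum_k entropy_var (U i j) k * dU i j 0 k) =
  \sum_i w i * (\sum_k gstar false i 0 k * entropy_var (U i ord0) k
       - ct_psi_g (m i ord0) (U i ord0))
  - \sum_i w i * (\sum_k gstar true i 0 k * entropy_var (U i ord_max) k
       - ct_psi_g (m i ord_max) (U i ord_max))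
  + \sum_j w j * (\sum_k fstar false j 0 k * entropy_var (U ord0 j) k
       - ct_psi_f (m ord0 j) (U ord0 j))
  - \sum_j w j * (\sum_k fstar true j 0 k * entropy_var (U ord_max j) k
       - ct_psi_f (m ord_max j) (U ord_max j)).
Proof.
move=> dmi dg; have sbp := summation_by_parts xi N_gt0 xi_lgl.
have sumD := sum_diff_mx xi xi_lgl.
(* The sum over components goes outside, since each one is tested with its own [V_k]. *)
have -> : \sum_i \sum_j w i * w j * jac_det (m i j)
     * (\sum_k entropy_var (U i j) k * dU i j 0 k) =
   \sum_k \sum_i \sum_j
     w i * w j * jac_det (m i j) * dU i j 0 k * entropy_var (U i j) k.
  rewrite [RHS]exchange_big; apply: eq_bigr => i _; rewrite [RHS]exchange_big.
  apply: eq_bigr => j _; rewrite mulr_sumr; apply: eq_bigr => k _; ring.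
under eq_bigr => k _ do
  rewrite (dgsem_tested (fun i j => entropy_var (U i j) k) k dg).
rewrite big_split /= exchange_big [X in _ + X = _]exchange_big /=.
under eq_bigr => j _ do
  rewrite (line_entropy_surface _ _ sbp sumD
  (a_xi j) (b_xi j) (U^~ j) (admU^~ j) (F_xi j) (ct_xi j) (pot_xi j)
  (F_xiE j) (ct_xiE j) (pot_xiE j)).
under [X in _ + X = _]eq_bigr => i _ do
  rewrite (line_entropy_surface _ _ sbp sumD
  (a_eta i) (b_eta i) (U i) (admU i) (F_eta i) (ct_eta i) (pot_eta i)
  (F_etaE i) (fun _ _ => erefl) (fun _ => erefl)).
rewrite !sumrB.
set Mf := (X in _ - _ - X + _ = _); set Mg := (X in _ + (_ - X) = _).
have regroup (f0 fN M g0 gN : R) :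
  f0 - fN - M + (g0 - gN - - M) = g0 - gN + f0 - fN by ring.
(* [Mf] and [Mg] collect the potentials times discrete derivatives of the metric terms; the metric
   identities make them opposite node by node. *)
suff -> : Mg = - Mf by rewrite regroup.
rewrite /Mf /Mg -sumrN [RHS](eq_bigr (fun j => \sum_i - (w j * (w i * (
   psi_f (U i j) * (\sum_p D i p * m_yeta (m p j))
   + psi_g (U i j) * (\sum_p D i p * - m_xeta (m p j))))))); last first.
  by move=> j _; rewrite mulr_sumr sumrN.
rewrite exchange_big; apply: eq_bigr => i _; rewrite mulr_sumr.
apply: eq_bigr => j _ /=.
have [Ey Ex] := dmi i j.
under eq_bigr do rewrite mulrN.
under [X in _ = - (_ * (_ * (_ + _ * X)))]eq_bigr do rewrite mulrN.
rewrite !sumrN Ey Ex; ring.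
Qed.

End TestedScheme.

Theorem lemma3p1 (R : realType) (N : nat) (hN : (1 <= N)%N)
  (xi : 'I_N.+1 -> R) (hxi : lgl_points xi)
  (x y : R * R -> R) (Omega : set (R * R)) (hmap : element_mapping x y Omega)
  (m : 'I_N.+1 -> 'I_N.+1 -> metric R)
  (hm : forall i j, m i j = metric_at x y (node xi i j))
  (hdmi : discrete_metric_identities xi m)
  (T : set R) (hT : open T)
  (U : R -> R * R -> 'rV[R]_4)
  (hQN : forall t k, T t -> in_QN xi (fun q => U t q 0 k))
  (Un dUn : R -> 'I_N.+1 -> 'I_N.+1 -> 'rV[R]_4)
  (hUn : forall t i j, Un t i j = U t (node xi i j))
  (hdiff : forall t i j k, T t -> derivable (fun s : R => Un s i j 0 k) t 1)
  (hdUn : forall t i j k, dUn t i j 0 k = derive1 (fun s : R => Un s i j 0 k) t)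
  (hadm : forall t i j, T t -> admissible (Un t i j))
  (Uf Ug : R -> bool -> 'I_N.+1 -> 'rV[R]_4)
  (hUf : forall t b j, T t -> admissible (Uf t b j))
  (hUg : forall t b i, T t -> admissible (Ug t b i))
  (nf ng : bool -> 'I_N.+1 -> R * R)
  (hnf : forall b j, normal_on_xi_side (m (side_node b) j) b (nf b j))
  (hng : forall b i, normal_on_eta_side (m i (side_node b)) b (ng b i))
  (fstar gstar : R -> bool -> 'I_N.+1 -> 'rV[R]_4)
  (hfstar : forall t b j, fstar t b j =
     ct_fstar (m (side_node b) j) b (nf b j) (Un t (side_node b) j) (Uf t b j))
  (hgstar : forall t b i, gstar t b i =
     ct_gstar (m i (side_node b)) b (ng b i) (Un t i (side_node b)) (Ug t b i))
  (hdg : forall t, T t -> dgsem xi m (Un t) (dUn t) (fstar t) (gstar t)) :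
  forall t, T t ->
  (forall k : 'I_4,
     \sum_(p1 < N.+1) \sum_(p2 < N.+1)
        quad_weight xi p1 * quad_weight xi p2 * jac_det (m p1 p2)
          * dUn t p1 p2 0 k
     = \sum_(p1 < N.+1) quad_weight xi p1 *
         (gstar t false p1 0 k - gstar t true p1 0 k)
       + \sum_(p2 < N.+1) quad_weight xi p2 *
         (fstar t false p2 0 k - fstar t true p2 0 k))
  /\
  \sum_(p1 < N.+1) \sum_(p2 < N.+1)
     quad_weight xi p1 * quad_weight xi p2 * jac_det (m p1 p2)
       * derive1 (fun s : R => entropy (Un s p1 p2)) t
  = \sum_(p1 < N.+1) quad_weight xi p1 *
      (\sum_(k < 4) gstar t false p1 0 k * entropy_var (Un t p1 ord0) k
       - ct_psi_g (m p1 ord0) (Un t p1 ord0))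
    - \sum_(p1 < N.+1) quad_weight xi p1 *
      (\sum_(k < 4) gstar t true p1 0 k * entropy_var (Un t p1 ord_max) k
       - ct_psi_g (m p1 ord_max) (Un t p1 ord_max))
    + \sum_(p2 < N.+1) quad_weight xi p2 *
      (\sum_(k < 4) fstar t false p2 0 k * entropy_var (Un t ord0 p2) k
       - ct_psi_f (m ord0 p2) (Un t ord0 p2))
    - \sum_(p2 < N.+1) quad_weight xi p2 *
      (\sum_(k < 4) fstar t true p2 0 k * entropy_var (Un t ord_max p2) k
       - ct_psi_f (m ord_max p2) (Un t ord_max p2)).
Proof.
move=> t Tt; have dgt := hdg t Tt.
have admU i j : admissible (Un t i j) by exact: hadm.
split=> [k|]; first exact: (dgsem_conservation _ _ _ _ _ _ hN hxi admU _ dgt).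
rewrite -(dgsem_entropy _ _ _ _ _ _ hN hxi admU hdmi dgt).
apply: eq_bigr => i _; apply: eq_bigr => j _; congr (_ * _).
rewrite (derive1_entropy (fun s => Un s i j)) //; last by move=> k; exact: hdiff.
by apply: eq_bigr => k _; rewrite hdUn.
Qed.
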